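(* Let $\mathcal{L}^{(M)}$ be an exactly solvable operator that factorizes on $\mathbb{P}$, with factors $\rho_{m_1},\dots,\rho_{m_J}$ having only real zeros, and satisfying $$\sum_{i=1}^{j}(m_i-n_i)\ge0\quad\text{for all } j\le J,$$ and let $\mu$ be a positive Borel measure supported in $[-1,1]$. Then the zeros of all polynomials of the sequence $\{Q_n\}_{n=0}^{\infty}$ of monic polynomials orthogonal with respect to $(\mathcal{L}^{(M)},\mu)$ are located in a (closed) disk of radius $R=3^Md$, where $d=\max\{1,\sup_{z\in C_M}|z|\}$.
   Context: $\mathbb{P}$ is the space of polynomials. An exactly solvable operator of order $M$ is $\mathcal{L}^{(M)}=\sum_{k=0}^{M}\rho_k(z)\frac{d^k}{dz^k}$ with polynomials $\rho_k$, $\deg\rho_k\le k$ for all $k$, equality for at least one $k$, $\rho_M\not\equiv0$. For $M\ge1$, $\mathcal{L}^{(M)}$ factorizes on $\mathbb{P}$ if there exist multi-indices $(m_1,\dots,m_J)$, $(n_1,\dots,n_J)$ and polynomials $\rho_{m_j}$ with $\deg\rho_{m_j}=m_j$ such that for every polynomial $\Pi$ $$\mathcal{L}^{(M)}[\Pi]=\left[\rho_{m_J}\cdots\left[\rho_{m_2}\left[\rho_{m_1}\Pi\right]^{(n_1)}\right]^{(n_2)}\cdots\right]^{(n_J)}.$$ Exact solvability forces $\sum_{k=1}^J m_k=\sum_{k=1}^J n_k=M$. $C_M$ is the convex hull of the zeros of $\prod_{i=1}^J\rho_{m_i}$. $\mu$ is finite with infinite support. $Q_n$ is orthogonal with respect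 to $(\mathcal{L}^{(M)},\mu)$ (for the index $n$) if $\deg Q_n\le n$ and $\int\mathcal{L}^{(M)}[Q_n](x)P(x)\,d\mu(x)=0$ for every polynomial $P$ with $\deg P\le n-1$; under the displayed condition there is a unique sequence of such monic polynomials with $\deg Q_n=n$ for all $n$. *)

(* Defs.v *)
From HB Require Import structures.
From mathcomp Require Import all_boot all_order all_algebra.
From mathcomp Require Import all_classical all_reals all_analysis.
From mathcomp Require Import complex.
Set Implicit Arguments.
Unset Strict Implicit.
Unset Printing Implicit Defensive.
Import Order.TTheory GRing.Theory Num.Theory.
Import numFieldNormedType.Exports.
Local Open Scope classical_set_scope.
Local Open Scope complex_scope.
Local Open Scope ring_scope.

Section Operators.
Variable R : realType.

(* The values [rho k] for [M < k] play no role. *)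
Definition diff_op (M : nat) (rho : nat -> {poly R[i]})
    (p : {poly R[i]}) : {poly R[i]} :=
  \sum_(k < M.+1) rho k * p^`(k).

(* [size p] is one more than the degree, so [deg (rho k) <= k] is
   [size (rho k) <= k.+1]; since a zero polynomial has size 0, equality
   of sizes also says that [rho k] is nonzero. *)
Definition exactly_solvable (M : nat) (rho : nat -> {poly R[i]}) : Prop :=
  [/\ forall k, (k <= M)%N -> (size (rho k) <= k.+1)%N,
      exists2 k, (k <= M)%N & size (rho k) = k.+1
    & rho M != 0].

(* The innermost factor is the one of index 0: [foldl] applies
   [q |-> (f j * q)^(n j)] for [j = 0, ..., J - 1] in this order. *)
Definition factor_op (J : nat) (n : 'I_J -> nat) (f : 'I_J -> {poly R[i]})
    (p : {poly R[i]}) : {poly R[i]} :=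
  foldl (fun q j => (f j * q)^`(n j)) p (enum 'I_J).

Definition factorization (M : nat) (rho : nat -> {poly R[i]})
    (J : nat) (m n : 'I_J -> nat) (f : 'I_J -> {poly R[i]}) : Prop :=
  [/\ (0 < M)%N,
      forall j, size (f j) = (m j).+1
    & forall p, diff_op M rho p = factor_op n f p].

(* [Rcomplex R] is [R[i]] seen as a vector space over [R]. *)
Definition convex_hull (S : set R[i]) : set R[i] :=
  smallest (@convex_set R (Rcomplex R)) S.

Definition zeros_hull (J : nat) (f : 'I_J -> {poly R[i]}) : set R[i] :=
  convex_hull [set z | root (\prod_(j < J) f j) z].

Definition hull_radius (J : nat) (f : 'I_J -> {poly R[i]}) : R :=
  Num.max 1 (sup [set Normc.normc z | z in zeros_hull f]).

End Operators.

Section Orthogonality.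
Variable R : realType.
Implicit Type mu : {finite_measure set (measurableTypeR R) -> \bar R}.

Definition msupport mu : set R :=
  [set x | forall U : set R, open_nbhs x U -> (0 < mu U)%E].

Definition Cintegral mu (g : R -> R[i]) : R[i] :=
  (\int[mu]_x complex.Re (g x)) +i* (\int[mu]_x complex.Im (g x)).

(* [deg P <= n - 1] is [size P <= n]; for [n = 0] only [P = 0] qualifies. *)
Definition orthogonal_poly (M : nat) (rho : nat -> {poly R[i]}) mu
    (n : nat) (q : {poly R[i]}) : Prop :=
  (size q <= n.+1)%N /\
  forall P : {poly R[i]}, (size P <= n)%N ->
    Cintegral mu (fun x => (diff_op M rho q).[x%:C] * P.[x%:C]) = 0.

Definition monic_orthogonal_seq (M : nat) (rho : nat -> {poly R[i]}) mu
    (Q : nat -> {poly R[i]}) : Prop :=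
  forall n, [/\ Q n \is monic, size (Q n) = n.+1
              & orthogonal_poly M rho mu n (Q n)].

End Orthogonality.

(* Main.v *)
Require Import Defs.
From HB Require Import structures.
From mathcomp Require Import all_boot all_order all_algebra.
From mathcomp Require Import all_classical all_reals all_analysis.
From mathcomp Require Import complex polyrcf.
From mathcomp Require Import measurable_realfun.
From mathcomp Require Import ring lra zify.
Set Implicit Arguments.
Unset Strict Implicit.
Unset Printing Implicit Defensive.
Import Order.TTheory GRing.Theory Num.Theory.
Import numFieldNormedType.Exports.
Local Open Scope classical_set_scope.
Local Open Scope complex_scope.
Local Open Scope ring_scope.

(** Fix k and let L denote the operator.  The partial-sum hypothesis makes
    every composite of the first j steps raise degrees by the nonnegative
    amount [\sum_(i < j) (m i - n i)], so no derivative annihilates anything.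
    Since L does not raise degrees, the total excess is 0, hence L preserves
    degrees and is injective ([size_apply_steps_eq], [apply_steps_inj]).
    Evaluating L at a high power of [X - a], where [a] is a zero of no factor,
    shows that the derivatives taken number at most M ([steps_order_le]).

    By orthogonality, [L (Q k)] has degree k and is orthogonal to all lower
    degrees, so the classical argument puts its zeros in [-1, 1]
    ([orthogonal_root]).  Therefore [L (Q k)] is real up to a scalar, and so
    are the factors; as L is injective and commutes with conjugation up to a
    scalar, [Q k] is real ([monic_real_preimage]).

    It remains to go back from [L (Q k)] to [Q k], undoing one derivative at a
    time.  Write d for [hull_radius f].  Multiplying by a factor of degree m
    adds m zeros in the real interval [-d, d], and by Rolle's theorem, with
    multiplicities, a derivative loses at most one of them
    ([rolle_multiplicity]).  The partial-sum hypothesis says exactly that there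
    is a zero left to lose before each derivative.  So each step back has the
    following form: p' has its zeros in a disk of radius r >= d about 0, and p
    vanishes at some point a of that disk.  Then the zeros of p lie in the disk
    of radius 3 r ([root_antiderivative_disk]): if p vanished at z with
    |z| > 3 r, every zero of p' would be closer to a than to z, that is, in an
    open half-plane bounded by the perpendicular bisector of a and z, and
    Grace's theorem for half-planes ([grace_half_plane]) would give
    p(z) <> p(a).  At most M steps back, starting from the radius d >= 1, give
    the radius 3^M d. *)

(** * Grace's theorem for half-planes *)

Section Grace.
Variable C : numClosedFieldType.
Implicit Types (x z w e t : C) (p : {poly C}).

(** The inversion x -> 1/x exchanges the half-plane on the right of 1/2 and the
    closed unit disk about 1, without 0.  Disks make means easy to control. *)
Lemma Re_ge_half x : (2^-1 <= 'Re x) = (x != 0) && (`|x^-1 - 1| <= 1).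
Proof.
have [->|x0] := eqVneq x 0.
  by rewrite raddf0 /= invr_le0 lern0.
have -> : x^-1 - 1 = (1 - x) / x by rewrite mulrBl mul1r divff.
rewrite normrM normfV ler_pdivrMr ?normr_gt0 // mul1r.
rewrite -[RHS](@ler_pXn2r _ 2) ?nnegrE ?normr_ge0 // !normCK.
rewrite rmorphB rmorph1 ReE -subr_ge0 -[RHS]subr_ge0.
have -> : x * x^* - (1 - x) * (1 - x^*) = 2 * ((x + x^*) / 2 - 2^-1) by field.
by rewrite pmulr_rge0 ?ltr0n.
Qed.

Lemma coef1_prod_XsubC (s : seq C) (p := \prod_(z <- s) ('X - z%:P)) :
  p`_0 != 0 -> p`_1 = - p`_0 * \sum_(z <- s) z^-1.
Proof.
rewrite {}/p; elim: s => [|z s IH]; first by rewrite !big_nil mulr0 !coef1.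
rewrite !big_cons !mulrBl !coefB !coefXM !coefCM /= sub0r oppr_eq0 mulf_eq0.
rewrite negb_or => /andP[z0 /[dup] q0 /IH ->].
by field.
Qed.

(** The mean of N + 1 points of the closed disk of radius 1 about 1 is in this
    disk.  When [s] is too short, the missing terms count as copies of 0, which
    is on the boundary of the disk. *)
Lemma mean_inv_half_plane (s : seq C) (N : nat) x : (size s <= N.+1)%N ->
  (forall y, y \in s -> 2^-1 <= 'Re y) ->
  x != 0 -> \sum_(y <- s) y^-1 = N.+1%:R / x -> 2^-1 <= 'Re x.
Proof.
move=> sN hs x0 sumE.
rewrite Re_ge_half x0 -(ler_pM2l (ltr0Sn C N)) mulr1.
rewrite -[X in X * `|_|]normr_nat -normrM mulrBr mulr1 -sumE.
have -> : \sum_(y <- s) y^-1 - N.+1%:R =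
    \sum_(y <- s) (y^-1 - 1) - (N.+1 - size s)%:R.
  rewrite sumrB big_const_seq count_predT iter_addr_0 natrB //.
  by ring.
rewrite (le_trans (ler_normB _ _)) // normr_nat -lerBrDr -natrB ?leq_subr //.
rewrite subKn // (le_trans (ler_norm_sum _ _ _)) //.
rewrite -[size s]count_predT -sum1_count natr_sum !big_seq ler_sum // => y ys.
by have := hs y ys; rewrite Re_ge_half => /andP[].
Qed.

(** Laguerre's theorem on polar derivatives, with the reference point moved to
    0: p(0) and p'(0) are the coefficients of index 0 and 1, and the sum below
    is the polar derivative of p, as a polynomial of degree N + 1, at 0.  If it
    vanished, then (N + 1) / z would be the sum of the 1 / y over the zeros y of
    p.  A scaling turns the half-plane of the y into the one on the right of 1/2,
    so z would lie with them, by [mean_inv_half_plane]. *)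
Lemma laguerre_half_plane p (N : nat) e t z :
  (size p <= N.+2)%N -> p`_0 != 0 ->
  (forall y, root p y -> t <= 'Re (e * y)) -> 0 < t -> 'Re (e * z) < t ->
  N.+1%:R * p`_0 + z * p`_1 != 0.
Proof.
move=> sp p00 hp t0 ht.
have [s pE] := closed_field_poly_normal p; rewrite pE !coefZ.
set q := \prod_(z <- s) _ in pE *.
have [l0 q0] : lead_coef p != 0 /\ q`_0 != 0.
  by apply/andP; rewrite -negb_or -mulf_eq0 -coefZ -pE.
rewrite coef1_prod_XsubC // -/q.
have [->|z0] := eqVneq z 0; first by rewrite mul0r addr0 !mulf_neq0 // pnatr_eq0.
apply: contraTneq ht => eq0.
have sE : \sum_(y <- s) y^-1 = N.+1%:R / z.
  apply: (mulfI (mulf_neq0 l0 q0)); apply: (mulfI z0).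
  set S := \sum_(y <- s) _ in eq0 *.
  move/eqP: eq0; rewrite addrC addr_eq0 => /eqP eq0.
  have -> : z * (lead_coef p * q`_0 * S) = - (z * (lead_coef p * (- q`_0 * S))).
    by ring.
  by rewrite eq0 opprK; field.
have tR : t \is Num.real by rewrite gtr0_real.
have e0 : e != 0.
  apply/eqP => e0.
  have : exists y, root p y.
    apply/closed_rootP; rewrite pE size_scale // size_prod_XsubC.
    case: (s) sE => // /esym/eqP; rewrite big_nil mulf_eq0 invr_eq0 (negPf z0).
    by rewrite pnatr_eq0.
  by case=> y /hp; rewrite e0 mul0r raddf0 (lt_geF t0).
pose c := e / (2 * t).
have ReM y : 'Re (c * y) = 'Re (e * y) / (2 * t).
  rewrite /c mulrAC; apply: ReMr.
  by have : (2 * t)^-1 \is Num.real by rewrite realV realM ?realn.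
(* The factor c maps the half-plane of the zeros of p to the one on the right
   of 1/2. *)
have half y : (2^-1 <= 'Re (c * y)) = (t <= 'Re (e * y)).
  rewrite ReM ler_pdivlMr ?mulr_gt0 ?ltr0n //.
  by rewrite mulrA mulVf ?pnatr_eq0 // mul1r.
rewrite -real_leNgt ?Creal_Re // -half.
have c0 : c != 0 by rewrite mulf_neq0 // invr_neq0 // mulf_neq0 ?pnatr_eq0 // lt0r_neq0.
apply: (@mean_inv_half_plane [seq c * y | y <- s] N).
- have /eqP := congr1 (size \o polyseq) pE.
  rewrite /= size_scale // size_prod_XsubC size_map => /eqP E.
  by rewrite -ltnS -E.
- move=> _ /mapP[y ys ->]; rewrite half; apply: hp.
  by rewrite pE rootZ // root_prod_XsubC.
- by rewrite mulf_neq0.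
rewrite big_map (eq_bigr (fun y => c^-1 * y^-1)); last first.
  by move=> y _; rewrite invfM.
by rewrite -mulr_sumr sE; field; rewrite c0 z0.
Qed.

(** Grace's theorem, with apolarity expressed by a linear form L.  By induction
    on the number of points: replacing [L] by p |-> L ((X - w) p) amounts to
    taking a polar derivative of z |-> L ((X - z)^N) with pole w, and by
    Laguerre's theorem this creates no zero in the half-plane.  The point [z0]
    only ensures that the half-plane is not empty. *)
Lemma grace_half_plane (e t z0 : C) (s : seq C) (L : {poly C} -> C) :
  scalar L -> 'Re (e * z0) < t ->
  (forall z, 'Re (e * z) < t -> L (('X - z%:P) ^+ size s) != 0) ->
  (forall y, y \in s -> 'Re (e * y) < t) ->
  L (\prod_(y <- s) ('X - y%:P)) != 0.
Proof.
move=> + hz0; elim: s L => [|w s IH] L linL hL hs.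
  by rewrite big_nil; apply: (hL z0).
rewrite big_cons.
apply: (IH (fun p => L (('X - w%:P) * p))); last 1 first.
- by move=> y ys; apply: hs; rewrite inE ys orbT.
- by move=> a p q; rewrite mulrDr -scalerAr linL.
move=> z hz; set N := size s.
have L0 : L 0 = 0.
  by apply: (addIr (L 0)); rewrite add0r -[X in X + _]mul1r -linL scaler0 addr0.
have LZ a p : L (a *: p) = a * L p by rewrite -[a *: p]addr0 linL L0 addr0.
have LD p q : L (p + q) = L p + L q by rewrite -[p]scale1r linL mul1r scale1r.
(* G(y) = L ((X - z - y)^(N + 1)), expanded in powers of y. *)
pose G := \poly_(i < N.+2)
  ('C(N.+1, i)%:R * (-1) ^+ i * L (('X - z%:P) ^+ (N.+1 - i))).
have GE y : G.[y] = L (('X - (z + y)%:P) ^+ N.+1).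
  rewrite horner_poly polyCD opprD addrA exprBn (big_morph L LD L0).
  apply: eq_bigr => i _.
  have -> : (-1) ^+ i * ('X - z%:P) ^+ (N.+1 - i) * y%:P ^+ i *+ 'C(N.+1, i)
    = ('C(N.+1, i)%:R * (-1) ^+ i * y ^+ i) *: ('X - z%:P) ^+ (N.+1 - i).
    rewrite -mul_polyC !polyCM !rmorphXn /= polyCN polyC_natr -mulr_natl.
    by ring.
  by rewrite LZ; ring.
have -> : ('X - w%:P) * ('X - z%:P) ^+ N
   = ('X - z%:P) ^+ N.+1 + (z - w) *: ('X - z%:P) ^+ N.
  by rewrite exprS -mul_polyC polyCB; ring.
have tR : t \is Num.real.
  rewrite -(subrK ('Re (e * z)) t) realD ?Creal_Re // gtr0_real //.
  by rewrite subr_gt0.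
have n0 : N.+1%:R != 0 :> C by rewrite pnatr_eq0.
rewrite LD LZ -(mulrI_eq0 _ (mulfI n0)).
have -> : N.+1%:R * (L (('X - z%:P) ^+ N.+1) + (z - w) * L (('X - z%:P) ^+ N)) =
   N.+1%:R * G`_0 + (w - z) * G`_1.
  by rewrite !coef_poly /= bin0 bin1 subn0 subn1 /= expr0 expr1; ring.
apply: (@laguerre_half_plane _ _ e (t - 'Re (e * z))).
- exact: size_poly.
- by rewrite coef_poly /= bin0 subn0 expr0 !mul1r; apply: hL.
- move=> y; rewrite /root GE lerBlDl -raddfD -mulrDr => Ly0.
  by rewrite real_leNgt ?Creal_Re //; apply: contraL Ly0; apply: hL.
- by rewrite subr_gt0.
- by rewrite ltrBDl -raddfD -mulrDr addrC subrK hs ?mem_head.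
Qed.

Lemma Re_lt_bisector (a z w : C) :
  ('Re (2 * (z - a)^* * w) < `|z| ^+ 2 - `|a| ^+ 2) = (`|w - a| < `|w - z|).
Proof.
rewrite -[RHS](@ltr_pXn2r _ 2) ?nnegrE ?normr_ge0 // !normCK.
rewrite -[LHS]subr_gt0 -[RHS]subr_gt0 ReE !rmorphM !rmorphB /= !conjCK rmorph_nat.
by congr (_ < _); field.
Qed.

(** The linear form r |-> \int_a^z r, written on coefficients up to a bound B so
    that its linearity is immediate. *)
Lemma weighted_coef_deriv (a z : C) (q : {poly C}) (B : nat) :
  (size q <= B.+1)%N ->
  \sum_(i < B) q^`()`_i * ((z ^+ i.+1 - a ^+ i.+1) / i.+1%:R) =
  q.[z] - q.[a].
Proof.
move=> sq; rewrite !(horner_coef_wide _ sq) -sumrB big_ord_recl /= !expr0 subrr add0r.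
apply: eq_bigr => i _; rewrite coef_deriv -[_ *+ i.+1]mulr_natr -mulrBr /bump /= add1n.
by rewrite mulrA [X in X / _]mulrAC mulfK ?pnatr_eq0.
Qed.

(** With |z| > 3 r, every w of the disk of radius r satisfies
    |w - a| <= 2 r < |w - z|.  Grace's theorem for this half-plane and the form
    p' |-> p(z) - p(a) then forbids p(z) = p(a), because the form maps
    (X - w)^N to a multiple of (z - w)^(N + 1) - (a - w)^(N + 1), and the two
    powers have different moduli. *)
Lemma root_antiderivative_disk (p : {poly C}) (a z r : C) :
  p^`() != 0 -> (forall w, root p^`() w -> `|w| <= r) ->
  root p a -> `|a| <= r -> root p z -> `|z| <= 3 * r.
Proof.
move=> p0 hp pa ar pz.
have r0 : 0 <= r by apply: le_trans ar.
have rR : r \is Num.real by rewrite ger0_real.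
rewrite real_leNgt ?realM ?realn ?normr_real //; apply/negP => zr.
pose e := 2 * (z - a)^*; pose t := `|z| ^+ 2 - `|a| ^+ 2.
have hH w : `|w| <= r -> 'Re (e * w) < t.
  move=> wr; rewrite Re_lt_bisector.
  apply: (@le_lt_trans _ _ (2 * r)).
    by rewrite mulr_natl mulr2n (le_trans (ler_normB _ _)) // lerD.
  rewrite distrC; apply: (@lt_le_trans _ _ (`|z| - r)).
    by rewrite ltrBrDr; move: zr; rewrite -natr1 mulrDl mul1r.
  by rewrite (le_trans _ (lerB_normD _ _)) // normrN lerB.
have [s pE] := closed_field_poly_normal p^`().
have l0 : lead_coef p^`() != 0 by rewrite lead_coef_eq0.
(* B exceeds the degrees of p and of each power of X - w used below. *)
pose B := (size p + size s).+1.
pose L (q : {poly C}) := \sum_(i < B) q`_i * ((z ^+ i.+1 - a ^+ i.+1) / i.+1%:R).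
have linL : scalar L.
  move=> c q q'; rewrite /L mulr_sumr -big_split; apply: eq_bigr => i _ /=.
  by rewrite coefD coefZ mulrDl mulrA.
have L0 : L 0 = 0 by rewrite /L big1 // => i _; rewrite coef0 mul0r.
have LD : L p^`() = 0.
  rewrite /L weighted_coef_deriv; last first.
    by rewrite !leqW // leq_addr.
  by rewrite (rootP pz) (rootP pa) subrr.
suff : L (\prod_(y <- s) ('X - y%:P)) != 0.
  apply/negP; rewrite negbK.
  have := linL (lead_coef p^`()) (\prod_(y <- s) ('X - y%:P)) 0.
  rewrite L0 !addr0 -pE LD => /esym/eqP.
  by rewrite mulf_eq0 (negPf l0).
apply: (@grace_half_plane e t a) => //; first exact: hH.
- move=> w; rewrite Re_lt_bisector => waz.
  have : L (('X - w%:P) ^+ (size s).+1)^`() != 0.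
    rewrite /L weighted_coef_deriv; last first.
      by rewrite size_exp_XsubC !ltnS leq_addl.
    rewrite !horner_exp !hornerXsubC subr_eq0; apply/eqP => /(congr1 Num.norm).
    rewrite !normrX => /eqP; rewrite eqrXn2 //; rewrite ![`|_ - w|]distrC => /eqP E.
    by rewrite E ltxx in waz.
  rewrite deriv_exp derivXsubC mul1r /= -scaler_nat.
  have := linL (size s).+1%:R (('X - w%:P) ^+ size s) 0.
  rewrite L0 !addr0 => ->.
  by rewrite mulf_eq0 negb_or => /andP[].
- by move=> y ys; apply/hH/hp; rewrite pE rootZ // root_prod_XsubC.
Qed.

End Grace.

(** * Rolle's theorem with multiplicities *)

Section Rolle.
Variable R : rcfType.
Implicit Types (p q : {poly R}) (s t : seq R).

Local Notation prodX s := (\prod_(x <- s) ('X - x%:P)).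

(** Each term of the derivative of the product lacks a single factor X - x, which
    q provides. *)
Lemma dvdp_deriv_prod_XsubC s q :
  (forall x, x \in s -> root q x) -> prodX s %| (prodX s)^`() * q.
Proof.
elim: s => [|x s IH] hs; first by rewrite big_nil dvd1p.
rewrite !big_cons derivM derivXsubC mul1r [X in _ %| X]mulrDl dvdp_add //.
  rewrite [X in X %| _]mulrC dvdp_mul // dvdp_XsubCl.
  by rewrite hs // mem_head.
rewrite -mulrA dvdp_mul // IH // => y ys.
by rewrite hs // inE ys orbT.
Qed.

(** The inequalities locate the new zeros, and the last conclusion keeps them
    apart from the old ones, for combination with multiplicities. *)
Lemma rolle_sorted p y s : path <%R y s -> all (root p) (y :: s) ->
  exists t, [/\ size t = size s, uniq t, all (root p^`()) t,
    forall x, x \in t -> y < x <= last y s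
    & forall x, x \in t -> x \notin y :: s].
Proof.
elim: s y => [|z s IH] y /=; first by exists [::].
move=> /andP[yz pz] /andP[py ps].
have [t [ts ut rt lt nt]] := IH z pz ps.
have pz0 : root p z by case/andP: ps.
have [x xyz rx] : exists2 x, x \in `]y, z[ & p^`().[x] = 0.
  have [|x] := poly_rolle yz (_ : p.[y] = p.[z]); last by exists x.
    by rewrite (rootP py) (rootP pz0).
have zs w : w \in z :: s -> z <= w.
  rewrite inE => /orP[/eqP->//|]. move: pz; rewrite (path_sortedE lt_trans).
  by move=> /andP[/allP h _] /h /ltW.
move: xyz; rewrite in_itv /= => /andP[yx xz].
exists (x :: t); split.
- by rewrite /= ts.
- rewrite /= ut andbT; apply/negP => /lt /andP[zx _].
  by have := lt_trans xz zx; rewrite ltxx.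
- by rewrite /= rt andbT; apply/rootP.
- move=> w; rewrite inE => /orP[/eqP->|/lt/andP[zw ->]].
    rewrite yx /= (le_trans (ltW xz)) // zs // mem_last //.
  by rewrite andbT (lt_trans yz zw).
- move=> w; rewrite inE => /orP[/eqP->|wt].
    rewrite inE negb_or gt_eqF //=; apply/negP => /zs.
    by rewrite leNgt xz.
  rewrite inE negb_or (nt _ wt) andbT gt_eqF //.
  by have /andP[zw _] := lt _ wt; apply: lt_trans zw.
Qed.

(** Split the zeros of p into one copy of each, [u], and the rest, [s'].  The
    product over [s'] divides p', by [dvdp_deriv_prod_XsubC], and the zeros
    between those of [u] are zeros of the cofactor, since they are not in
    [s']. *)
Lemma rolle_multiplicity (d : R) p s :
  (0 < size s)%N -> all (fun x => `|x| <= d) s -> prodX s %| p ->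
  exists t, [/\ size t = (size s).-1, all (fun x => `|x| <= d) t
              & prodX t %| p^`()].
Proof.
move=> s0 sd /dvdpP[g pE].
pose u := sort <=%R (undup s).
have us : {subset u <= s} by move=> x; rewrite mem_sort mem_undup.
have [s' sE] : exists s', perm_eq s (u ++ s').
  have [s' sE] := perm_to_subseq (undup_subseq s).
  exists s'; apply: perm_trans sE _; rewrite perm_cat2r perm_sym.
  by apply/permPl/perm_sort.
have s's : {subset s' <= u}.
  move=> x xs'; rewrite mem_sort mem_undup (perm_mem sE) mem_cat xs' orbT //.
have : sorted <%R u by rewrite sort_lt_sorted undup_uniq.
have u0 : (0 < size u)%N.
  rewrite size_sort lt0n size_eq0; apply: contraTneq s0 => /undup_nil ->.
  by [].
have := perm_size sE; rewrite size_cat.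
have allu : all (root p) u.
  apply/allP => x /us xs; rewrite pE rootM root_prod_XsubC xs orbT //.
have pE' : p^`() = (prodX s')^`() * prodX u * g + prodX s' * (prodX u * g)^`().
  have -> : p = prodX s' * (prodX u * g).
    by rewrite pE (perm_big _ sE) big_cat /=; ring.
  by rewrite [LHS]derivM mulrA.
have /dvdpP[h hE] : prodX s' %| p^`().
  rewrite pE' dvdp_add //; [apply: dvdp_mulr|exact: dvdp_mulr].
  apply: dvdp_deriv_prod_XsubC => x /s's xu.
  by rewrite root_prod_XsubC.
have sub_d x : x \in u -> - d <= x <= d.
  by move=> /us /(allP sd); rewrite ler_norml.
case: u us s's u0 allu {pE' sE} sub_d => // y u us s's _ allu sub_d szE path_u.
have [t [ts ut rt lt nt]] := rolle_sorted path_u allu.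
exists (t ++ s'); split.
- by rewrite size_cat ts szE.
- rewrite all_cat; apply/andP; split; apply/allP => x.
    move=> /lt /andP[yx xl]; rewrite ler_norml.
    have /andP[dy _] := sub_d y (mem_head _ _).
    have /andP[_ ld] := sub_d _ (mem_last y u).
    by rewrite (le_trans dy (ltW yx)) (le_trans xl ld).
  by move=> /s's/us; apply: (allP sd).
rewrite big_cat /= hE dvdp_mul // uniq_roots_dvdp ?uniq_rootsE //.
apply/allP => x xt; have := allP rt x xt; rewrite hE rootM root_prod_XsubC.
by case/orP=> // /s's xu; have := nt x xt; rewrite xu.
Qed.

End Rolle.

(** * Multiplication and differentiation steps *)

Section Steps.
Variable K : numFieldType.
Implicit Types (p q : {poly K}) (s : seq (nat * {poly K})).

Definition apply_steps s p := foldl (fun q c => (c.2 * q)^`(c.1)) p s.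
Definition total_order s := (\sum_(c <- s) c.1)%N.
Definition total_degree s := (\sum_(c <- s) (size c.2).-1)%N.

(** Starting from k zeros, the number of available zeros never becomes negative,
    a multiplication adding its degree and a derivative removing one. *)
Definition balanced k s :=
  forall j, (total_order (take j s) <= k + total_degree (take j s))%N.

Lemma balanced_cons k c s : balanced k (c :: s) ->
  (c.1 <= k + (size c.2).-1)%N /\ balanced (k + (size c.2).-1 - c.1) s.
Proof.
move=> bal; split.
  by have := bal 1; rewrite /= take0 /total_order /total_degree !big_seq1.
move=> j; have := bal j.+1; have := bal 1.
rewrite /= take0 /total_order /total_degree !big_seq1 !big_cons.
set a := (\sum_(_ <- _) _)%N; set b := (\sum_(_ <- _) _)%N.
by move: c.1 (size c.2).-1 a b => u v w x; lia.
Qed.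

Lemma size_derivn p n : size p^`(n) = (size p - n)%N.
Proof.
elim: n => [|n IH]; first by rewrite derivn0 subn0.
rewrite derivnS subnS -IH; set q := p^`(n).
have [/eqP|q0] := posnP (size q).
  by rewrite size_poly_eq0 => /eqP ->; rewrite raddf0 size_poly0.
have [/size1_polyC -> |q1] := leqP (size q) 1.
  by rewrite derivC size_poly0 size_polyC; case: (_ != 0).
apply/eqP; rewrite eqn_leq -ltnS prednK //.
rewrite lt_size_deriv -?size_poly_gt0 //=.
rewrite leqNgt; apply/negP => H.
have : q^`()`_(size q).-2 = 0.
  by apply: nth_default; move: H q1; case: (size q) => [|[|k]].
rewrite coef_deriv (_ : (size q).-2.+1 = (size q).-1); last by lia.
move/eqP; rewrite mulrn_eq0 -lead_coefE lead_coef_eq0 -size_poly_eq0.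
by move: q1; case: (size q) => [|[|k]].
Qed.

Lemma size_apply_steps s p : p != 0 -> (forall c, c \in s -> c.2 != 0) ->
  balanced (size p).-1 s ->
  (size (apply_steps s p) + total_order s = size p + total_degree s)%N.
Proof.
elim: s p => [|c s IH] p p0 cs; first by rewrite /total_order /total_degree !big_nil.
move=> /balanced_cons[c1 bal].
have c0 : c.2 != 0 by rewrite cs ?mem_head.
have sq : size (c.2 * p)^`(c.1) = ((size p).-1 + (size c.2).-1 - c.1).+1.
  rewrite size_derivn size_mul //.
  move: p0 c0 c1; rewrite -!size_poly_gt0.
  by move: (size p) (size c.2) c.1 => x y z; lia.
have q0 : (c.2 * p)^`(c.1) != 0 by rewrite -size_poly_gt0 sq.
rewrite /total_order /total_degree !big_cons.
have cs' e : e \in s -> e.2 != 0 by move=> es; rewrite cs // inE es orbT.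
have := IH _ q0 cs'; rewrite sq /= => /(_ bal).
rewrite /total_order /total_degree /=.
set a := (\sum_(_ <- _) _)%N; set b := (\sum_(_ <- _) _)%N.
move: p0 c1; rewrite -!size_poly_gt0.
set l := size (apply_steps s _).
move: l (size p) (size c.2).-1 c.1 a b => x y z t u v.
lia.
Qed.

Lemma deriv_vanish a n p : ~~ root p a ->
  exists2 q, ~~ root q a & (('X - a%:P) ^+ n.+1 * p)^`() = ('X - a%:P) ^+ n * q.
Proof.
move=> pa; exists (n.+1%:R *: p + ('X - a%:P) * p^`()).
  by rewrite /root !hornerE subrr mul0r addr0 mulf_neq0 ?pnatr_eq0.
rewrite derivM deriv_exp derivXsubC mul1r /= exprS -mulr_natl scaler_nat -mulr_natl.
ring.
Qed.

Lemma derivn_vanish a k n p : ~~ root p a ->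
  exists2 q, ~~ root q a &
    (('X - a%:P) ^+ (n + k) * p)^`(k) = ('X - a%:P) ^+ n * q.
Proof.
elim: k n p => [|k IH] n p pa; first by exists p; rewrite ?addn0 ?derivn0.
have [q qa E] := deriv_vanish (n + k) pa.
have [r ra E'] := IH n q qa; exists r => //.
by rewrite derivSn addnS E E'.
Qed.

(** A derivative lowers a positive order of vanishing by exactly 1, and a factor
    that is nonzero at [a] does not change it. *)
Lemma apply_steps_vanish a s n p :
  (forall c, c \in s -> ~~ root c.2 a) -> ~~ root p a ->
  exists2 q, ~~ root q a &
    apply_steps s (('X - a%:P) ^+ (n + total_order s) * p) = ('X - a%:P) ^+ n * q.
Proof.
elim: s n p => [|c s IH] n p cs pa.
  by exists p; rewrite // /total_order big_nil addn0.
have ca : ~~ root (c.2 * p) a by rewrite rootM negb_or pa cs ?mem_head.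
have [q qa E] := derivn_vanish c.1 (n + total_order s) ca.
have [|r ra E'] := IH n q _ qa; first by move=> e es; rewrite cs // inE es orbT.
exists r => //; rewrite -E' -E /total_order big_cons /=.
by rewrite [(c.1 + _)%N]addnC addnA mulrCA.
Qed.

Lemma apply_steps_lin s a p q :
  apply_steps s (a *: p + q) = a *: apply_steps s p + apply_steps s q.
Proof.
elim: s p q => // c s IH p q /=.
by rewrite mulrDr -scalerAr derivnD derivnZ IH.
Qed.

Lemma apply_steps0 s : apply_steps s 0 = 0.
Proof. by elim: s => //= c s IH; rewrite mulr0 linear0. Qed.

Lemma apply_stepsZ s a p : apply_steps s (a *: p) = a *: apply_steps s p.
Proof. by rewrite -[a *: p]addr0 apply_steps_lin apply_steps0 addr0. Qed.

End Steps.

(** * Real zeros and the disks of the antiderivatives *)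

Section RealZeros.
Variable R : rcfType.
Implicit Types (d : R) (p q : {poly R[i]}) (s : seq (nat * {poly R[i]})).

Local Notation toC := (map_poly (real_complex R)).

(** The scalar lets the predicate hold for the factors, whose leading
    coefficients are arbitrary complex numbers, while Rolle's theorem applies to
    the real polynomial [p0]. *)
Definition real_zeros d (k : nat) p := exists (c : R[i]) (p0 : {poly R}) (t : seq R),
  [/\ p = c *: toC p0, size t = k, all (fun x => `|x| <= d) t
    & \prod_(x <- t) ('X - x%:P) %| p0].

Lemma real_zerosM d j k p q :
  real_zeros d j p -> real_zeros d k q -> real_zeros d (j + k) (p * q).
Proof.
move=> [c [p0 [t [-> <- td tp]]]] [e [q0 [u [-> <- ud uq]]]].
exists (c * e), (p0 * q0), (t ++ u); split.
- by rewrite rmorphM /= -scalerAl -scalerAr scalerA.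
- by rewrite size_cat.
- by rewrite all_cat td.
- by rewrite big_cat dvdp_mul.
Qed.

Lemma real_zeros_deriv d k p : real_zeros d k.+1 p -> real_zeros d k p^`().
Proof.
move=> [c [p0 [t [-> tk td tp]]]].
have [|u [uk ud up]] := rolle_multiplicity _ td tp; first by rewrite tk.
exists c, p0^`(), u; split=> //; first by rewrite derivZ deriv_map.
by rewrite uk tk.
Qed.

Lemma real_zeros_root d k p : real_zeros d k.+1 p ->
  exists2 x : R, `|x| <= d & root p x%:C.
Proof.
move=> [c [p0 [[|x t] [-> // tk /andP[xd _] tp]]]]; exists x => //.
rewrite /root hornerZ (_ : (toC p0).[x%:C] = (p0.[x])%:C) ?horner_map //.
suff /rootP -> : root p0 x by rewrite mulr0.
by rewrite -dvdp_XsubCl (dvdp_trans _ tp) // big_cons dvdp_mulIl.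
Qed.

Lemma real_zeros_real_roots d p :
  (forall z, root p z -> z \is Num.real /\ `|z| <= d%:C) ->
  real_zeros d (size p).-1 p.
Proof.
move=> hp; have [->|p0] := eqVneq p 0.
  by exists 0, 0, [::]; rewrite size_poly0 scale0r dvdp0.
have [s pE] := closed_field_poly_normal p.
have l0 : lead_coef p != 0 by rewrite lead_coef_eq0.
have hs z : z \in s -> z \is Num.real /\ `|z| <= d%:C.
  by move=> zs; apply: hp; rewrite pE rootZ // root_prod_XsubC.
exists (lead_coef p), (\prod_(x <- map (@complex.Re R) s) ('X - x%:P)),
  (map (@complex.Re R) s); split.
- rewrite {1}pE rmorph_prod big_map; congr (_ *: _); apply: eq_big_seq => z /hs[zR _].
  by rewrite /= map_polyXsubC; congr ('X - _%:P); rewrite [RHS]RRe_real.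
- by rewrite pE size_scale // size_prod_XsubC size_map.
- apply/allP => _ /mapP[z /hs[zR zd] ->].
  rewrite -lecR (le_trans _ zd) // -{2}(RRe_real zR) normc_def /=.
  by rewrite expr0n addr0 sqrtr_sqr.
by [].
Qed.

(** There being at least n zeros in [-d, d], each of the n successive
    antiderivatives vanishes somewhere in this interval. *)
Lemma root_antiderivativen_disk d (r : R) n k p :
  real_zeros d (n + k) p -> p^`(n) != 0 -> d <= r ->
  (forall z, root p^`(n) z -> `|z| <= r%:C) ->
  forall z, root p z -> `|z| <= (3 ^+ n * r)%:C.
Proof.
elim: n p => [|n IH] p pz pn dr hp z.
  by rewrite expr0 mul1r; apply: hp.
have [x xd px] := real_zeros_root pz.
have r0 : 0 <= r by rewrite (le_trans _ dr) // (le_trans _ xd).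
have pz' := real_zeros_deriv pz.
rewrite exprS -mulrA rmorphM /= rmorph_nat; apply: root_antiderivative_disk px _.
- by apply: contraNneq pn; rewrite derivSn => ->; rewrite linear0.
- by apply: (IH _ pz') => //; rewrite -derivSn.
- rewrite normc_def /= expr0n addr0 sqrtr_sqr lecR (le_trans xd) // (le_trans dr) //.
  by rewrite ler_peMl // exprn_ege1 // ler1n.
Qed.

Lemma real_zeros_derivn d n k p : real_zeros d (n + k) p -> real_zeros d k p^`(n).
Proof.
elim: n p => // n IH p /real_zeros_deriv /IH.
by rewrite derivSn.
Qed.

(** The zeros counted by [real_zeros] are pushed forward through the steps, while
    the bound on the moduli is pulled back; balance guarantees that there are
    enough zeros for each group of derivatives. *)
Lemma root_apply_steps_disk d (r : R) s k p :
  real_zeros d k p ->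
  (forall c, c \in s -> real_zeros d (size c.2).-1 c.2) ->
  balanced k s -> apply_steps s p != 0 -> d <= r ->
  (forall z, root (apply_steps s p) z -> `|z| <= r%:C) ->
  forall z, root p z -> `|z| <= (3 ^+ total_order s * r)%:C.
Proof.
elim: s k p => [|c s IH] k p pz cs bal s0 dr hs z.
  by rewrite /total_order big_nil mul1r; apply: hs.
have [ck {}bal] := balanced_cons bal.
move=> zp; have zcp : root (c.2 * p) z by rewrite rootM zp orbT.
have cz : real_zeros d (size c.2).-1 c.2 by apply: cs; rewrite mem_head.
have := real_zerosM cz pz.
rewrite addnC -(subnKC ck) => cpz.
have qz := real_zeros_derivn cpz.
rewrite /total_order big_cons exprD -mulrA.
have q0 : (c.2 * p)^`(c.1) != 0.
  apply: contraNneq s0 => /= ->.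
  by rewrite apply_steps0.
have cs' e : e \in s -> real_zeros d (size e.2).-1 e.2.
  by move=> es; apply: cs; rewrite inE es orbT.
have IHs := IH _ _ qz cs' bal s0 dr hs.
(* With no derivative there need not be any zero, so r may be negative. *)
have [n0|n0] := posnP c.1.
  rewrite n0 expr0 mul1r; apply: IHs; by rewrite n0 derivn0.
apply: (root_antiderivativen_disk cpz q0 _ _ zcp) => //.
move: n0 cpz; case: (c.1) => // n _ cpz.
have [x xd _] := real_zeros_root cpz.
have r0 : 0 <= r by rewrite (le_trans _ dr) // (le_trans _ xd).
by rewrite (le_trans dr) // ler_peMl // exprn_ege1 // ler1n.
Qed.

Local Notation conj_poly := (map_poly (@conjc R)).

Lemma real_zeros_conj d k p :
  real_zeros d k p -> exists v, conj_poly p = v *: p.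
Proof.
move=> [a [f [t [-> _ _ _]]]].
have [->|a0] := eqVneq a 0; first by exists 0; rewrite !scale0r rmorph0.
exists (conjc a / a); rewrite scalerA divfK //.
apply/polyP => i; rewrite coef_map !coefZ coef_map /= rmorphM /=.
by rewrite oppr0.
Qed.

(** The conjugate of a factor is a scalar multiple of this factor. *)
Lemma apply_steps_conj d s :
  (forall c, c \in s -> real_zeros d (size c.2).-1 c.2) ->
  exists u, forall p, conj_poly (apply_steps s p) = u *: apply_steps s (conj_poly p).
Proof.
elim: s => [|c s IH] cs; first by exists 1 => p; rewrite scale1r.
have [|u uE] := IH; first by move=> e es; apply: cs; rewrite inE es orbT.
have [v vE] := real_zeros_conj (cs c (mem_head _ _)).
exists (u * v) => p; rewrite /= uE -derivn_map rmorphM /=.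
rewrite vE -scalerAl derivnZ -scalerA; congr (_ *: _).
exact: apply_stepsZ.
Qed.

End RealZeros.

(** * Integrals of polynomials against a compactly supported measure *)

Section Support.
Variable R : realType.
Variable mu : {finite_measure set (measurableTypeR R) -> \bar R}.

(** Each point outside of the support lies in an open interval with rational
    endpoints and measure 0, and there are countably many such intervals. *)
Lemma negligible_setC_msupport : mu.-negligible (~` msupport mu).
Proof.
pose I (ab : rat * rat) : set (measurableTypeR R) := (`]ratr ab.1, ratr ab.2[)%classic.
pose F k := if unpickle k is Some ab then
              if mu (I ab) == 0%E then I ab else set0 else set0.
have F0 k : mu.-negligible (F k).
  rewrite /F; case: unpickle => [ab|]; last exact: negligible_set0.
  case: eqVneq => [I0|_]; last exact: negligible_set0.
  by apply/negligibleP => //; apply: measurable_itv.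
apply: negligibleS (negligible_bigcup F0) => x /= /existsNP[U].
move=> /not_implyP[[oU Ux] /negP]; rewrite -leNgt measure_le0 => /eqP U0.
have : nbhs x U by apply: open_nbhs_nbhs.
move=> /nbhs_ballP[e /= e0 xeU].
have xe : x - e < x by rewrite ltrBlDr ltrDl.
have ex : x < x + e by rewrite ltrDl.
have [a] := rat_in_itvoo xe; have [b] := rat_in_itvoo ex.
rewrite !in_itv /= => /andP[xb be] /andP[ea ax].
have IU : I (a, b) `<=` U.
  move=> y; rewrite /I /= in_itv /= => /andP[ay yb]; apply: xeU.
  by rewrite /ball /= ltr_norml; apply/andP; split; lra.
have [k kE] : exists k, unpickle k = Some (a, b).
  by exists (pickle (a, b)); apply: pickleK.
exists k; first exact: Logic.I.
rewrite /F kE.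
suff -> : mu (I (a, b)) = 0%E by rewrite eqxx /I /= in_itv /= ax xb.
apply/eqP; rewrite -measure_le0 -U0 le_measure // inE.
  exact: measurable_itv.
exact: open_measurable.
Qed.

Hypothesis mu_infinite : infinite_set (msupport mu).
Hypothesis mu_bounded : msupport mu `<=` `[-1, 1].
Local Notation A := (`[-1, 1]%classic : set (measurableTypeR R)).

Lemma measurable_horner (g : {poly R}) (D : set (measurableTypeR R)) :
  measurable D -> measurable_fun D (fun x : measurableTypeR R => g.[x] : measurableTypeR R).
Proof.
move=> mD; apply: measurable_funTS; apply: continuous_measurable_fun.
exact: continuous_horner.
Qed.

(** If the integral vanished, g would vanish almost everywhere.  But g is nonzero
    at some point of the support, which is infinite, and hence on an open set of
    positive measure. *)
Lemma Rintegral_poly_neq0 (g : {poly R}) : g != 0 ->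
  (forall x, -1 <= x <= 1 -> 0 <= g.[x]) ->
  \int[mu]_x g.[x] != 0.
Proof.
move=> g0 gge0.
have mA : measurable A by apply: measurable_itv.
have mNA : measurable (~` A) by apply: measurableC.
have NA0 : mu (~` A) = 0%E.
  apply/negligibleP => //; apply: negligibleS negligible_setC_msupport.
  exact: subsetC.
have AE : [set: measurableTypeR R] `\` ~` A = A by rewrite setTD setCK.
have mf D : measurable D -> measurable_fun D (fun x : measurableTypeR R => (g.[x])%:E).
  by move=> mD; apply/measurable_EFinP; apply: measurable_horner.
have intA : mu.-integrable A (fun x => (g.[x])%:E).
  apply: measurable_bounded_integrable => //.
  - by rewrite -ge0_fin_numE // fin_num_measure.
  - exact: measurable_horner.
  exists (\sum_(i < size g) `|g`_i|); split; first exact: num_real.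
  move=> M ltM x /=; rewrite in_itv /= -ler_norml => x1.
  rewrite (le_trans _ (ltW ltM)) // horner_coef (le_trans (ler_norm_sum _ _ _)) //.
  by apply: ler_sum => i _; rewrite normrM normrX ler_piMr // exprn_ile1.
have intT : mu.-integrable setT (fun x => (g.[x])%:E).
  by apply/(negligible_integrable mNA measurableT (mf _ measurableT) NA0); rewrite AE.
apply/eqP => /eqP; rewrite /Rintegral fine_eq0 ?integrable_fin_num // => /eqP.
rewrite (negligible_integral mNA measurableT intT NA0) AE => int0.
have : (\int[mu]_(x in A) `|(g.[x])%:E| = 0)%E.
  rewrite -int0; apply: eq_integral => x; rewrite inE /= in_itv /= => /gge0 gx.
  by rewrite ger0_norm.
move/(ae_eq_integral_abs mu mA (mf _ mA)) => ae0.
have [x0 [sx0 gx0]] : exists x0, msupport mu x0 /\ ~~ root g x0.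
  apply: contrapT => H; apply: mu_infinite.
  apply: (sub_finite_set _ (finite_seq (rootsR g))) => x sx /=.
  rewrite -(roots_on_rootsR g0) in_itv /=.
  by apply: contrapT => /negP gx; apply: H; exists x.
have open_g : open [set x | g.[x] != 0].
  by move/continuousP: (@continuous_horner _ g) => /(_ [set y | y != 0]); apply.
have : (0 < mu [set x | g.[x] != 0%R])%E by apply: sx0.
rewrite lt_neqAle eq_sym => /andP[/eqP + _]; apply.
apply/negligibleP; first exact: open_measurable.
apply: negligibleS (negligibleU ae0 (_ : mu.-negligible (~` A))); last exact/negligibleP.
move=> x /= gx; have [Ax|nAx] := pselect (A x); [left|by right].
by move=> /(_ Ax) [] /eqP; rewrite (negPf gx).
Qed.

End Support.

(** * Zeros of the factors and of orthogonal polynomials *)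

Lemma exists_nonroot_nat (K : numFieldType) (p : {poly K}) :
  p != 0 -> exists k : nat, ~~ root p k%:R.
Proof.
move=> p0; have : ~~ all (root p) [seq k%:R | k <- iota 0 (size p)].
  apply/negP => /(max_poly_roots p0).
  rewrite map_inj_uniq ?iota_uniq; last by apply: mulrIn; rewrite oner_eq0.
  by rewrite size_map size_iota ltnn => /(_ isT).
by rewrite all_map => /allPn[k _ pk]; exists k.
Qed.

Section ZerosHull.
Variable R : realType.
Implicit Type z : R[i].

Lemma normc_normC z : `|z| = (Normc.normc z)%:C.
Proof. by []. Qed.

(** Convexity of disks bounds the convex hull, so that the supremum defining
    [hull_radius] is an upper bound. *)
Lemma convex_disk (B : R) :
  convex_set ([set z | Normc.normc z <= B] : set (Rcomplex R)).
Proof.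
move=> x y t; rewrite !inE /= => xB yB.
have t0 : 0 <= t%:num by [].
have t1 : 0 <= 1 - t%:num by rewrite subr_ge0.
have normcZ (a : R) (w : R[i]) : 0 <= a ->
    Normc.normc (a *: (w : Rcomplex R)) = a * Normc.normc w.
  move=> a0; case: w => u v /=.
  by rewrite !exprMn -mulrDr sqrtrM ?sqr_ge0 // sqrtr_sqr ger0_norm.
rewrite -[X in Normc.normc X]/(t%:num *: (x : Rcomplex R) + (1 - t%:num) *: (y : Rcomplex R)).
apply: (le_trans (le_normcD _ _)); rewrite !normcZ //.
have -> : B = t%:num * B + (1 - t%:num) * B by ring.
by apply: lerD; apply: ler_wpM2l.
Qed.

Lemma root_le_hull_radius (J : nat) (f : 'I_J -> {poly R[i]}) j z :
  (forall j, f j != 0) -> root (f j) z -> Normc.normc z <= hull_radius f.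
Proof.
move=> f0 fz; rewrite /hull_radius le_max; apply/orP; right.
have F0 : \prod_(j < J) f j != 0 by apply/prodf_neq0.
have [s sE] := closed_field_poly_normal (\prod_(j < J) f j).
pose B := \sum_(z <- s) Normc.normc z.
have n0 (w : R[i]) : 0 <= Normc.normc w by rewrite -lecR -normc_normC normr_ge0.
have sB w : root (\prod_(j < J) f j) w -> Normc.normc w <= B.
  rewrite sE rootZ ?lead_coef_eq0 // root_prod_XsubC => ws.
  by rewrite /B (big_rem w ws) /= lerDl sumr_ge0.
apply: ub_le_sup.
  exists B => _ [w hw <-]; apply: (hw [set z | Normc.normc z <= B]).
  by split; [exact: convex_disk|move=> v /= /sB].
exists z => //; move=> A [_]; apply => /=.
by rewrite (bigD1 j) //= rootM fz.
Qed.

End ZerosHull.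

Section Orthogonal.
Variable R : realType.
Variable mu : {finite_measure set (measurableTypeR R) -> \bar R}.
Hypothesis mu_infinite : infinite_set (msupport mu).
Hypothesis mu_bounded : msupport mu `<=` `[-1, 1].

Definition Re_poly (p : {poly R[i]}) : {poly R} :=
  \poly_(i < size p) complex.Re p`_i.

Lemma horner_Re_poly p (x : R) : (Re_poly p).[x] = complex.Re p.[x%:C].
Proof.
rewrite horner_poly horner_coef.
rewrite (@big_morph _ _ (@complex.Re R) 0 +%R 0 +%R) //; last by case=> ? ? [].
apply: eq_bigr => i _; rewrite -rmorphXn /=; case: (p`_i) => a b /=.
by rewrite mulr0 subr0.
Qed.

(** A line strictly separates z from [-1, 1].  Multiplication by w rotates it to
    a vertical one, so that the real part, an affine function of x, is positive
    on the segment. *)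
Lemma separating_multiplier z : ~ (z \is Num.real /\ `|z| <= 1) ->
  exists (w : R[i]) (l : {poly R}),
    (forall x, complex.Re (w * (x%:C - z)) = l.[x]) /\
    (forall x, -1 <= x <= 1 -> 0 < l.[x]).
Proof.
case: z => u v; rewrite complex_real => H.
have [v0|v0] := eqVneq v 0; last first.
  exists (0 +i* v), (v ^+ 2)%:P; split => x; rewrite hornerC ?exprn_even_gt0 //=.
  by rewrite mul0r sub0r; ring.
have [u1|] := ltP 1 u.
  exists (-1), (u%:P - 'X); split => x; rewrite !hornerE /=; first by ring.
  lra.
have [u1 _|u1 u2] := ltP u (-1).
  exists 1, ('X - u%:P); split => x; rewrite !hornerE /=; first by ring.
  lra.
exfalso; apply: H; rewrite v0 eqxx; split => //.
by rewrite normc_def /= expr0n addr0 sqrtr_sqr lecR ler_norml u1.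
Qed.

(** Write q = S (X - z).  If z is not in [-1, 1], take w as in
    [separating_multiplier] and test q against w times the conjugate of S: the
    real part of the integrand is |S|^2 times an affine function which is positive
    on [-1, 1]. *)
Lemma orthogonal_root (k : nat) (q : {poly R[i]}) z :
  size q = k.+1 ->
  (forall P : {poly R[i]}, (size P <= k)%N ->
     Cintegral mu (fun x => q.[x%:C] * P.[x%:C]) = 0) ->
  root q z -> z \is Num.real /\ `|z| <= 1.
Proof.
move=> sq oq /factor_theorem[S qE]; apply: contrapT => /separating_multiplier.
move=> [w [l [lE l0]]].
have S0 : S != 0 by apply: contra_eq_neq sq => S0; rewrite qE S0 mul0r size_poly0.
pose P := w *: map_poly (@conjc R) S.
have sP : (size P <= k)%N.
  apply: leq_trans (size_scale_leq _ _) _; rewrite size_map_poly.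
  by rewrite -ltnS -sq qE size_mul ?polyXsubC_eq0 // size_XsubC addn2.
have [c Sc] := exists_nonroot_nat S0.
pose N := (Re_poly S) ^+ 2 + (Re_poly ('i%C *: S)) ^+ 2.
(* On the real line N is |S|^2, because Re (i S) = - Im S. *)
have NE x : N.[x] = complex.Re S.[x%:C] ^+ 2 + complex.Im S.[x%:C] ^+ 2.
  rewrite !hornerE !horner_Re_poly hornerZ; case: (S.[_]) => a b /=; ring.
have N0 : N != 0.
  apply: contraNneq Sc => N0; have := NE c%:R; rewrite N0 horner0.
  move/esym/eqP; rewrite paddr_eq0 ?sqr_ge0 // !sqrf_eq0 rmorph_nat => /andP[].
  by rewrite /root; case: (S.[_]) => a b /= /eqP -> /eqP ->.
have l00 : l != 0.
  by apply: contraTneq (l0 0 _) => [->|]; rewrite ?horner0 ?ltxx //; lra.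
have := Rintegral_poly_neq0 mu_infinite mu_bounded (mulf_neq0 l00 N0).
move=> /(_ _)/wrap[x x1|].
  by rewrite hornerM mulr_ge0 ?(ltW (l0 _ x1)) // NE addr_ge0 ?sqr_ge0.
move/eqP; apply.
have := congr1 (@complex.Re R) (oq P sP); rewrite /Cintegral /= => <-.
apply: eq_Rintegral => x _.
rewrite hornerM -lE NE qE hornerM hornerXsubC /P hornerZ.
have -> : (map_poly (@conjc R) S).[x%:C] = conjc S.[x%:C].
  by rewrite -{1}(conjc_real x) horner_map.
case: (S.[_]) => a b; case: (w) => ? ?; case: (x%:C - z) => ? ? /=; ring.
Qed.

End Orthogonal.

(** * The factorized operator *)

Section Factorization.
Variable R : realType.
Variables (M : nat) (rho : nat -> {poly R[i]}).
Variables (J : nat) (m n : 'I_J -> nat) (f : 'I_J -> {poly R[i]}).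

Let steps : seq (nat * {poly R[i]}) := [seq (n j, f j) | j <- enum 'I_J].

Lemma factor_opE p : factor_op n f p = apply_steps steps p.
Proof. by rewrite /factor_op /apply_steps /steps; elim: (enum _) p => /=. Qed.

Lemma sum_take_enum (F : 'I_J -> nat) j :
  (\sum_(i <- take j (enum 'I_J)) F i = \sum_(i < J | (i < minn j J)%N) F i)%N.
Proof.
suff -> : take j (enum 'I_J) = [seq i <- enum 'I_J | (val i < minn j J)%N].
  by rewrite big_filter big_enum_cond.
apply: (inj_map val_inj); rewrite map_take -(filter_map _ (fun i => i < minn j J)%N).
rewrite val_enum_ord take_iota.
by rewrite -[in RHS](add0n (minn j J)) filter_iota_ltn ?geq_minr.
Qed.

Hypothesis es : exactly_solvable M rho.
Hypothesis fact : factorization M rho m n f.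
Hypothesis partial_sums : forall j : nat, (j <= J)%N ->
  0 <= \sum_(i < J | (i < j)%N) ((m i)%:Z - (n i)%:Z).

Lemma balanced_steps : balanced 0 steps.
Proof.
move=> j; rewrite add0n /total_order /total_degree /steps -map_take !big_map /=.
rewrite [leqRHS](eq_bigr m) => [|i _]; last by case: fact => _ -> _.
rewrite !sum_take_enum.
have := partial_sums (geq_minr j J).
rewrite sumrB subr_ge0 -!(big_morph Posz PoszD (erefl _)) lez_nat.
by [].
Qed.

Lemma steps_neq0 c : c \in steps -> c.2 != 0.
Proof.
case/mapP => j _ -> /=; rewrite -size_poly_gt0.
by case: fact => _ -> _.
Qed.

Lemma size_factor_op p : p != 0 ->
  (size (apply_steps steps p) + total_order steps =
   size p + total_degree steps)%N.
Proof.
move=> p0; apply: size_apply_steps p0 steps_neq0 _ => j.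
by apply: leq_trans (balanced_steps j) _; rewrite add0n leq_addl.
Qed.

(** The operator maps the constant 1 to a constant, so that the total degree is
    at most the total order; balance gives the converse. *)
Lemma steps_degree_order : total_degree steps = total_order steps.
Proof.
apply/eqP; rewrite eqn_leq; apply/andP; split; last first.
  by have := balanced_steps (size steps); rewrite take_size add0n.
rewrite -(leq_add2l (size (1 : {poly R[i]}))) -size_factor_op ?oner_neq0 //.
rewrite leq_add2r size_poly1 -factor_opE.
case: fact es => _ _ <- [srho _ _].
rewrite /diff_op big_ord_recl /= ?derivn0 mulr1 big1 ?addr0 ?srho // => i _.
by rewrite -derivnS derivSn -polyC1 derivC linear0 mulr0.
Qed.

(** At a zero [a] of no factor, the factorized form maps (X - a)^N, for N the total
    order, to a polynomial that is nonzero at a; with fewer than N derivatives,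
    the value at a would be 0. *)
Lemma steps_order_le : (total_order steps <= M)%N.
Proof.
rewrite leqNgt; apply/negP => ltM.
have F0 : \prod_(j < J) f j != 0.
  by apply/prodf_neq0 => j _; rewrite -size_poly_gt0; case: fact => _ -> _.
have [a Fa] := exists_nonroot_nat F0.
have ca c : c \in steps -> ~~ root c.2 a%:R.
  case/mapP => j _ -> /=; apply: contra Fa => fa.
  by rewrite (bigD1 j) //= rootM fa.
have r1 : ~~ root (1 : {poly R[i]}) a%:R by rewrite /root hornerC oner_eq0.
have [q qa] := apply_steps_vanish 0 ca r1.
rewrite mulr1 add0n expr0 mul1r -factor_opE; case: fact => _ _ <- qE.
move: qa; rewrite -qE /root /diff_op horner_sum big1 ?eqxx // => k _.
rewrite hornerM.
have kN : (k < total_order steps)%N by apply: leq_ltn_trans (leq_ord k) ltM.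
have [r _] := derivn_vanish k (total_order steps - k) r1.
rewrite (subnK (ltnW kN)) mulr1 => ->.
by rewrite hornerM horner_exp hornerXsubC subrr expr0n subn_eq0 leqNgt kN mul0r mulr0.
Qed.

Lemma size_apply_steps_eq p : size (apply_steps steps p) = size p.
Proof.
have [->|p0] := eqVneq p 0; first by rewrite apply_steps0.
by apply/eqP; rewrite -(eqn_add2r (total_order steps)) size_factor_op // steps_degree_order.
Qed.

Lemma apply_steps_inj : injective (apply_steps steps).
Proof.
move=> p q E; apply/eqP; rewrite -subr_eq0 -size_poly_eq0 -size_apply_steps_eq.
by rewrite addrC -scaleN1r apply_steps_lin E scaleN1r addNr size_poly0.
Qed.

(** The polynomial and its conjugate have proportional images, so they are
    proportional by injectivity, and equal since both are monic. *)
Lemma monic_real_preimage d k q :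
  (forall j z, root (f j) z -> z \is Num.real /\ `|z| <= d%:C) ->
  q \is monic -> real_zeros d k (apply_steps steps q) -> real_zeros d 0 q.
Proof.
move=> fd qm /real_zeros_conj[v vE].
have [|u uE] := @apply_steps_conj R d steps.
  by move=> c /mapP[j _ ->] /=; apply: real_zeros_real_roots => z; apply: fd.
have qE : v *: q = u *: map_poly (@conjc R) q.
  by apply: apply_steps_inj; rewrite !apply_stepsZ -vE uE.
have uv : u = v.
  have := congr1 lead_coef qE; rewrite !lead_coefZ (monicP qm) mulr1.
  rewrite (_ : lead_coef _ = 1) ?mulr1 //.
  by apply/monicP; rewrite map_monic.
(* v = 0 would make the image of q zero, hence q = 0. *)
have v0 : v != 0.
  apply: contraTneq qm => v0; move: vE; rewrite v0 scale0r => /eqP.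
  rewrite map_poly_eq0 -size_poly_eq0 size_apply_steps_eq size_poly_eq0 => /eqP ->.
  by rewrite monicE lead_coef0 eq_sym oner_eq0.
have qq : map_poly (@conjc R) q = q.
  by apply: (scalerI v0); rewrite qE uv.
exists 1, (Re_poly q), [::]; rewrite big_nil dvd1p; split=> //.
rewrite scale1r; apply/polyP => i.
have : conjc q`_i = q`_i by rewrite -[in RHS]qq coef_map.
rewrite coef_map coef_poly; case: ltnP => [_|/leq_sizeP -> //].
case: (q`_i) => a b [] /eqP; rewrite eq_sym -subr_eq0 opprK -mulr2n mulrn_eq0 /=.
by move/eqP ->.
Qed.

End Factorization.

Theorem theorem17 (R : realType) (M : nat) (rho : nat -> {poly R[i]})
    (J : nat) (m n : 'I_J -> nat) (f : 'I_J -> {poly R[i]})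
    (mu : {finite_measure set (measurableTypeR R) -> \bar R})
    (Q : nat -> {poly R[i]}) :
  exactly_solvable M rho ->
  factorization M rho m n f ->
  (forall (j : 'I_J) (z : R[i]), root (f j) z -> z \is Num.real) ->
  (forall j : nat, (j <= J)%N ->
     0 <= \sum_(i < J | (i < j)%N) ((m i)%:Z - (n i)%:Z)) ->
  infinite_set (msupport mu) ->
  msupport mu `<=` `[-1, 1] ->
  monic_orthogonal_seq M rho mu Q ->
  forall (k : nat) (z : R[i]), root (Q k) z ->
    Normc.normc z <= 3 ^+ M * hull_radius f.
Proof.
move=> es fact freal partial_sums mu_inf mu_bd orthQ k z Qz.
have [Qm sQ [_ oQ]] := orthQ k.
pose steps : seq (nat * {poly R[i]}) := [seq (n j, f j) | j <- enum 'I_J].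
pose d := hull_radius f.
have d1 : 1 <= d by rewrite /d /hull_radius le_max lexx.
have f0 j : f j != 0 by rewrite -size_poly_gt0; case: fact => _ -> _.
have fd j w : root (f j) w -> w \is Num.real /\ `|w| <= d%:C.
  by move=> fw; rewrite normc_normC lecR; split; [exact: freal fw|exact: root_le_hull_radius fw].
have LE p : diff_op M rho p = apply_steps steps p.
  by case: fact => _ _ ->; apply: factor_opE.
have sL p := size_apply_steps_eq es fact partial_sums p.
have Ld w : root (apply_steps steps (Q k)) w -> w \is Num.real /\ `|w| <= d%:C.
  move=> Lw.
  have [||wR w1] := @orthogonal_root R mu mu_inf mu_bd k _ w _ _ Lw.
  - by rewrite sL.
  - by move=> P sP; rewrite -LE; apply: oQ.
  by split=> //; rewrite (le_trans w1) // lecR.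
have Qreal := monic_real_preimage es fact partial_sums fd Qm (real_zeros_real_roots Ld).
have fz c : c \in steps -> real_zeros d (size c.2).-1 c.2.
  by move=> /mapP[j _ ->] /=; apply: real_zeros_real_roots => w; apply: fd.
have L0 : apply_steps steps (Q k) != 0 by rewrite -size_poly_gt0 sL sQ.
have := root_apply_steps_disk Qreal fz (balanced_steps fact partial_sums) L0
  (lexx d) (fun w Lw => proj2 (Ld w Lw)) Qz.
rewrite normc_normC lecR => /le_trans; apply.
rewrite ler_wpM2r ?(le_trans ler01) //.
by rewrite ler_weXn2l ?ler1n // (steps_order_le fact).
Qed.
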